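(* Let $I$ be a finite set and let $C$ be a finite set of partially defined real-valued functions on $I$, each $c\in C$ having a nonempty domain $\mathrm{Dom}(c)\subseteq I$, such that for every $i\in I$ the set $C$ contains a function with domain $\{i\}$. Then there exists a compromise function $x:I\to\mathbb R$ for $C$, i.e. a function such that (1) for every $c\in C$ there is $i\in\mathrm{Dom}(c)$ with $c(i)\le x(i)$, and (2) for every $i\in I$ there is $c\in C$ with $i\in\mathrm{Dom}(c)$ and $x(j)\le c(j)$ for all $j\in\mathrm{Dom}(c)$. *)

(* Defs.v *)
From mathcomp Require Import all_boot all_order all_algebra.
From mathcomp Require Import finmap reals.
Set Implicit Arguments.
Unset Strict Implicit.
Unset Printing Implicit Defensive.
Import Order.TTheory GRing.Theory Num.Theory.
Local Open Scope ring_scope.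

(* A partially defined function on I with values in R: [c i = Some r] means *)
(* that i is in the domain of c and c(i) = r. *)
Notation partial_fun I R := {ffun I -> option R}.

Definition Dom (I : finType) (R : realType) (c : partial_fun I R) : {set I} :=
  [set i | c i != None].

Definition compromise (I : finType) (R : realType)
    (C : {fset partial_fun I R}) (x : I -> R) : Prop :=
  (forall c, c \in C -> exists i r, c i = Some r /\ r <= x i) /\
  (forall i, exists c, [/\ c \in C, i \in Dom c &
     forall j r, c j = Some r -> x j <= r]).

(* Main.v *)
Require Import Defs.
From mathcomp Require Import all_boot all_order all_algebra.
From mathcomp Require Import finmap reals.
Set Implicit Arguments.
Unset Strict Implicit.
Unset Printing Implicit Defensive.
Import Order.TTheory.
Local Open Scope order_scope.

(** Condition (1) holds for every sufficiently large function, and condition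
    (2) at a point [i] survives when [x] is decreased.  Hence one starts from a
    large [x] and lowers its coordinates one after the other, each as far as
    condition (1) permits.  Lowering [x i] is obstructed only by the functions
    that satisfy condition (1) nowhere else than at [i]; one with the greatest
    value at [i] then witnesses condition (2) at [i]. *)

Lemma exists_max_Some d (T : orderType d) (K : finType) (P : pred K)
    (f : K -> option T) :
  (exists2 k, P k & f k != None) ->
  exists k r, [/\ P k, f k = Some r &
    forall l s, P l -> f l = Some s -> s <= r].
Proof.
move=> [k0 Pk0]; case fk0: (f k0) => [r0|] // _.
pose Q := [pred k | P k & f k != None].
have Qk0 : Q k0 by rewrite /= Pk0 fk0.
case: (arg_maxP (fun k => odflt r0 (f k)) Qk0) => k /andP[Pk].
case fk: (f k) => [r|] // _ max_k; exists k, r; split=> // l s Pl fl.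
by have := max_k l; rewrite /= Pl fl; apply.
Qed.

Section PartialFunctionFamily.

Variables (d : Order.disp_t) (T : orderType d) (K I : finType).
Variable c : K -> I -> option T.

Implicit Types (x y : I -> T) (i j : I) (k : K) (r : T).

Definition dom k : {set I} := [set i | c k i != None].

Definition meets x k i : bool := if c k i is Some r then r <= x i else false.

Definition feasible x : Prop := forall k, exists i, meets x k i.

Definition supported x i : Prop :=
  exists2 k, i \in dom k & forall j r, c k j = Some r -> x j <= r.

Definition binding x i k : bool :=
  (i \in dom k) && [forall (j | j != i), ~~ meets x k j].

Lemma supported_le x y i :
  (forall j, y j <= x j) -> supported x i -> supported y i.
Proof.
by move=> yx [k ik xk]; exists k => // j r /xk; apply: le_trans (yx j).
Qed.

Lemma exists_feasible :
  (forall k, dom k != set0) -> (forall i, exists k, i \in dom k) ->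
  exists x, feasible x.
Proof.
move=> dom_neq0 dom_cover.
have [|x x_ub] := @fin_all_exists I (fun=> T)
    (fun i r => forall k s, c k i = Some s -> s <= r).
  move=> i; have [k ik] := dom_cover i.
  have [|_ [r [_ _ r_max]]] := @exists_max_Some _ _ _ predT (c ^~ i).
    by exists k => //; rewrite inE in ik.
  by exists r => l s; apply: r_max.
exists x => k; have /set0Pn[i] := dom_neq0 k; rewrite inE => ik.
by exists i; rewrite /meets; case ck: (c k i) ik => [r|] // _; apply: x_ub ck.
Qed.

Lemma binding_le x i k r :
  feasible x -> binding x i k -> c k i = Some r -> r <= x i.
Proof.
move=> /(_ k)[j xkj] /andP[_ /forall_inP unmet] cki.
have [ji|/unmet] := eqVneq j i; last by rewrite xkj.
by move: xkj; rewrite ji /meets cki.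
Qed.

Lemma feasible_update x i r :
  feasible x -> (forall k s, binding x i k -> c k i = Some s -> s <= r) ->
  feasible [eta x with i |-> r].
Proof.
move=> feas_x r_ub k.
have meets_off j : j != i -> meets x k j -> meets [eta x with i |-> r] k j.
  by rewrite /meets /= => /negbTE->.
have [bind_k|] := boolP (binding x i k).
  exists i; have /andP[] := bind_k; rewrite inE /meets /= eqxx => ik _.
  by case cki: (c k i) ik => [s|] // _; apply: r_ub cki.
rewrite negb_and => /orP[ik|/forall_inPn[j ji]]; last first.
  by rewrite negbK => /(meets_off _ ji); exists j.
have [j xkj] := feas_x k; exists j; apply: meets_off => //.
by apply: contraNneq ik => <-; move: xkj; rewrite inE /meets; case: (c k j).
Qed.

Lemma supported_update x i k r :
  binding x i k -> c k i = Some r -> supported [eta x with i |-> r] i.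
Proof.
move=> /andP[ik /forall_inP unmet] cki; exists k => //= j s ckj.
have [ji|/unmet] := eqVneq j i; first by move: ckj; rewrite ji cki => -[->].
by rewrite /meets ckj -ltNge => /ltW.
Qed.

Lemma binding_singleton x i k : dom k = [set i] -> binding x i k.
Proof.
move=> dom_k; rewrite /binding dom_k set11; apply/forall_inP => j.
by rewrite -in_set1 -dom_k inE negbK /meets => /eqP->.
Qed.

Lemma exists_feasible_le_supported x i :
  (exists k, dom k = [set i]) -> feasible x ->
  exists y, [/\ feasible y, forall j, y j <= x j & supported y i].
Proof.
move=> [k0 dom_k0] feas_x.
have bind_k0 := binding_singleton x dom_k0.
have [|k [r [bind_k cki r_max]]] :=
    @exists_max_Some _ _ _ (binding x i) (c ^~ i).
  by exists k0 => //; have /andP[] := bind_k0; rewrite inE.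
exists [eta x with i |-> r]; split.
- exact: feasible_update.
- by move=> j /=; case: eqP => // ->; apply: binding_le cki.
- exact: supported_update cki.
Qed.

Lemma exists_feasible_supported :
  (forall k, dom k != set0) -> (forall i, exists k, dom k = [set i]) ->
  exists2 x, feasible x & forall i, supported x i.
Proof.
move=> dom_neq0 dom_singleton.
suff [x feas_x supp_x] :
    exists2 x, feasible x & forall i, i \in enum I -> supported x i.
  by exists x => // i; apply: supp_x; rewrite mem_enum.
elim: (enum I) => [|i s [x feas_x supp_x]].
  have [|x feas_x] := exists_feasible dom_neq0; last by exists x.
  by move=> i; have [k dom_k] := dom_singleton i; exists k; rewrite dom_k set11.
have [y [feas_y yx supp_y]] :=
  exists_feasible_le_supported (dom_singleton i) feas_x.
exists y => // j; rewrite inE => /predU1P[-> //|/supp_x].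
exact: supported_le.
Qed.

End PartialFunctionFamily.

Theorem theoremB1 (R : realType) (I : finType) (C : {fset partial_fun I R})
    (domC_neq0 : forall c, c \in C -> Dom c != set0)
    (singC : forall i : I, exists2 c, c \in C & Dom c = [set i]) :
  exists x : I -> R, compromise C x.
Proof.
have [k|i|x feas_x supp_x] :=
  @exists_feasible_supported _ R C I (fun k => val k).
- exact: domC_neq0 (valP k).
- by have [c cC dom_c] := singC i; exists [` cC]%fset.
exists x; split=> [c cC|i].
  have [i] := feas_x [` cC]%fset; rewrite /meets /=.
  by case ci: (c i) => [r|] // rx; exists i, r.
by have [k ik xk] := supp_x i; exists (val k); split=> //; apply: valP.
Qed.
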